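(* Let $G$ be a finite group, $M_1,\ldots,M_N$ a collection of $G$-Mackey functors, and write $M=M_1\boxtimes\cdots\boxtimes M_N$. For subgroups $H\leq L\leq G$ define $S_H^L=M_1(G/H)\otimes\cdots\otimes M_N(G/H)$ (tensor products over $\mathbb{Z}$). Then for each $L\leq G$ $$M(G/L)=\Big(\bigoplus_{H\leq L}S_H^L\Big)/F,$$ where $F$ is the subgroup generated by the Frobenius relations $$S_K^L\ni x_1\otimes\cdots\otimes x_{i-1}\otimes\mathrm{Tr}_H^K(x_i)\otimes x_{i+1}\otimes\cdots\otimes x_N=\mathrm{Res}_H^K(x_1)\otimes\cdots\otimes\mathrm{Res}_H^K(x_{i-1})\otimes x_i\otimes\mathrm{Res}_H^K(x_{i+1})\otimes\cdots\otimes\mathrm{Res}_H^K(x_N)\in S_H^L$$ for all $H\leq K\leq L$, all $i$, all $x_i\in M_i(G/H)$ and $x_j\in M_j(G/K)$ ($j\neq i$), and the Weyl relations $$S_H^L\ni x_1\otimes\cdots\otimes x_N=c_\ell(x_1)\otimes\cdots\otimes c_\ell(x_N)\in S_{\ell H\ell^{-1}}^L$$ for all $H\leq L$ and $\ell\in L$. Under this identification, the structure maps of $M$ are as follows. (1) The isomorphisms $c_g:M(G/L)\to M(G/gLg^{-1})$ are induced by $S_H^L\ni x_1\otimes\cdots\otimes x_N\mapsto c_g(x_1)\otimes\cdots\otimes c_g(x_N)\in S_{gHg^{-1}}^{gLg^{-1}}$. (2) For $L\leq L'$, the transfer $\mathrm{Tr}_L^{L'}:M(G/L)\to M(G/L')$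 is induced by the identity isomorphisms $S_H^L\to S_H^{L'}$, $H\leq L$. (3) For $L\leq L'$, the restriction $\mathrm{Res}_L^{L'}:M(G/L')\to M(G/L)$ is given on each component $S_H^{L'}$ by $$\mathrm{Res}_L^{L'}(x_1\otimes\cdots\otimes x_N)=\sum_{g\in L\backslash L'/H}c_g\big(\mathrm{Res}^H_{H\cap g^{-1}Lg}(x_1)\big)\otimes\cdots\otimes c_g\big(\mathrm{Res}^H_{H\cap g^{-1}Lg}(x_N)\big),$$ where the summand indexed by $g$ lies in $S^L_{gHg^{-1}\cap L}$. (4) The universal Dress pairing $f_L:M_1(G/L)\otimes\cdots\otimes M_N(G/L)\to M(G/L)$ is induced by the identity map $M_1(G/L)\otimes\cdots\otimes M_N(G/L)\to S_L^L$.
   Context: Let $G$ be a finite group. A $G$-Mackey functor $M$ consists of abelian groups $M(G/H)$ for $H\leq G$; isomorphisms $c_g:M(G/H)\to M(G/gHg^{-1})$ for $g\in G$ with $c_h=\mathrm{id}$ on $M(G/H)$ for $h\in H$ and $c_{g'}c_g=c_{g'g}$; and homomorphisms $\mathrm{Res}_H^K:M(G/K)\to M(G/H)$, $\mathrm{Tr}_H^K:M(G/H)\to M(G/K)$ for $H\leq K$, which are functorial in subgroup inclusions ($\mathrm{Res}_H^H=\mathrm{Tr}_H^H=\mathrm{id}$), satisfy $c_g\mathrm{Res}_H^K=\mathrm{Res}_{gHg^{-1}}^{gKg^{-1}}c_g$ and $c_g\mathrm{Tr}_H^K=\mathrm{Tr}_{gHg^{-1}}^{gKg^{-1}}c_g$,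 and the double coset formula $\mathrm{Res}_K^L\mathrm{Tr}_H^L=\sum_{g\in K\backslash L/H}\mathrm{Tr}_{K\cap gHg^{-1}}^K c_g\mathrm{Res}^H_{H\cap g^{-1}Kg}$ for $H,K\leq L$. The box product $M_1\boxtimes\cdots\boxtimes M_N$ is Day convolution with respect to the Cartesian product of finite $G$-sets. Equivalently, it is the Mackey functor with a universal Dress pairing: morphisms of Mackey functors $M_1\boxtimes\cdots\boxtimes M_N\to P$ correspond naturally to families of homomorphisms $f_H:M_1(G/H)\otimes\cdots\otimes M_N(G/H)\to P(G/H)$, $H\leq G$ (Dress pairings), such that (a) $f_H\circ(\mathrm{Res}_H^K\otimes\cdots\otimes\mathrm{Res}_H^K)=\mathrm{Res}_H^K\circ f_K$ for $H\leq K$; (b) $f_{gHg^{-1}}\circ(c_g\otimes\cdots\otimes c_g)=c_g\circ f_H$; (c) for every $i$ and $H\leq K$, $\mathrm{Tr}_H^K\circ f_H\circ(\mathrm{Res}_H^K\otimes\cdots\otimes\mathrm{id}_i\otimes\cdots\otimes\mathrm{Res}_H^K)=f_K\circ(\mathrm{id}\otimes\cdots\otimes\mathrm{Tr}_H^K\otimes\cdots\otimes\mathrm{id})$, with $\mathrm{id}_i$ and $\mathrm{Tr}_H^K$ in the $i$-th factor. The universal Dress pairing is the one corresponding to the identity of $M_1\boxtimes\cdots\boxtimes M_N$. *)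

(* Defs.v *)
From HB Require Import structures.
From mathcomp Require Import all_boot all_order all_algebra all_fingroup.
From mathcomp Require Import ring_quotient generic_quotient.
From mathcomp Require Import monalg boolp.

Set Implicit Arguments.
Unset Strict Implicit.
Unset Printing Implicit Defensive.

Import GRing.Theory.
Local Open Scope ring_scope.
Local Open Scope quotient_scope.

Section Generated.
Variables (V : zmodType) (R : V -> Prop).

Inductive generated : V -> Prop :=
| gen_mem r : R r -> generated r
| gen_zero : generated 0
| gen_sub u v : generated u -> generated v -> generated (u - v).

(* Membership is made boolean classically, as {quot _} requires. *)
Definition gensub : {pred V} := fun v => `[< generated v >].

Lemma gensub_zmod_closed : zmod_closed gensub.
Proof.
split=> [|u v /asboolP gu /asboolP gv]; apply/asboolP.
  exact: gen_zero.
exact: gen_sub.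
Qed.

HB.instance Definition _ := GRing.isZmodClosed.Build V gensub gensub_zmod_closed.

Definition genquot : zmodType := Quotient.quot gensub.

Definition gencl : {additive V -> genquot} := \pi_(Quotient.quot gensub).
End Generated.

Section DirectSum.
Variables (I : finType) (A : I -> zmodType).
Local Notation S := {dffun forall i : I, A i}.

Definition dsum_zero : S := [ffun i => 0 : A i].
Definition dsum_opp (u : S) : S := [ffun i => - u i : A i].
Definition dsum_add (u v : S) : S := [ffun i => u i + v i : A i].

Fact dsum_addA : associative dsum_add.
Proof. by move=> u v w; apply/ffunP=> i; rewrite !ffunE addrA. Qed.
Fact dsum_addC : commutative dsum_add.
Proof. by move=> u v; apply/ffunP=> i; rewrite !ffunE addrC. Qed.
Fact dsum_add0 : left_id dsum_zero dsum_add.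
Proof. by move=> u; apply/ffunP=> i; rewrite !ffunE add0r. Qed.
Fact dsum_addN : left_inverse dsum_zero dsum_opp dsum_add.
Proof. by move=> u; apply/ffunP=> i; rewrite !ffunE addNr. Qed.

HB.instance Definition _ :=
  GRing.isZmodule.Build S dsum_addA dsum_addC dsum_add0 dsum_addN.

Definition dsum : zmodType := S.

Definition dsum_in i (a : A i) : dsum :=
  [ffun j => dfwith (fun k => 0 : A k) a j].

Lemma dsum_in_is_zmod_morphism i : zmod_morphism (@dsum_in i : A i -> dsum).
Proof.
move=> a b; apply/ffunP=> j; rewrite !ffunE.
by case: dfwithP => [|k ik]; rewrite ?dfwith_in // !dfwith_out // subr0.
Qed.
HB.instance Definition _ i :=
  GRing.isZmodMorphism.Build (A i) dsum (@dsum_in i) (@dsum_in_is_zmod_morphism i).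
End DirectSum.

Section Tensor.
Variables (I : finType) (A : I -> zmodType).
Local Notation family := {dffun forall i : I, A i}.

Definition fam (x : forall i, A i) : family := [ffun i => x i].

Inductive multilinear_rel : {malg family} -> Prop :=
| MultilinearRel (x : forall i, A i) i (a b : A i) :
    multilinear_rel (<< fam (dfwith x (a + b)) >>
                     - << fam (dfwith x a) >> - << fam (dfwith x b) >>).

Definition tensor : zmodType := genquot multilinear_rel.

Definition pure (x : forall i, A i) : tensor := gencl multilinear_rel << fam x >>.
End Tensor.

(* In MathComp, [H :^ x] is [x^-1 H x]. *)
Definition gconj (gT : finGroupType) (g : gT) (H : {group gT}) : {group gT} :=
  (H :^ g^-1)%G.

Lemma gconj_cap (gT : finGroupType) (g : gT) (H K : {group gT}) :
  (K :&: gconj g H)%G = gconj g (H :&: gconj g^-1 K)%G.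
Proof. by apply: val_inj; rewrite /= conjIg invgK conjsgK setIC. Qed.

(* K \ L / H, as a partition of L when K and H are subgroups of L. *)
Definition dcosets (gT : finGroupType) (K H L : {group gT}) : {set {set gT}} :=
  [set (K :* g * H)%g | g in L].

(* [mval M H] is M(G/H). The group G is the whole of gT. To avoid transports between the groups
   [M (gconj 1 H)] and [M H], etc., conjugation by g is a map [M H -> M K] for
   every K equal to [gconj g H]; the equality proof is irrelevant since
   {group gT} is an eqType. Bijectivity of [cj] is [cj_bij] below. *)
Record mackey (gT : finGroupType) := Mackey {
  mval :> {group gT} -> zmodType;
  cj : forall (g : gT) (H K : {group gT}),
    K = gconj g H -> {additive mval H -> mval K};
  res : forall H K : {group gT}, H \subset K -> {additive mval K -> mval H};
  tr : forall H K : {group gT}, H \subset K -> {additive mval H -> mval K};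
  cj_id : forall (H : {group gT}) h (e : H = gconj h H) x,
    h \in H -> cj e x = x;
  cj_comp : forall g g' (H K L : {group gT}) (e : K = gconj g H)
      (e' : L = gconj g' K) (e'' : L = gconj (g' * g)%g H) x,
    cj e' (cj e x) = cj e'' x;
  res_id : forall (H : {group gT}) (s : H \subset H) x, res s x = x;
  res_comp : forall (H K L : {group gT}) (s : H \subset K) (s' : K \subset L)
      (s'' : H \subset L) x, res s (res s' x) = res s'' x;
  tr_id : forall (H : {group gT}) (s : H \subset H) x, tr s x = x;
  tr_comp : forall (H K L : {group gT}) (s : H \subset K) (s' : K \subset L)
      (s'' : H \subset L) x, tr s' (tr s x) = tr s'' x;
  cj_res : forall g (H K H' K' : {group gT}) (eH : H' = gconj g H)
      (eK : K' = gconj g K) (s : H \subset K) (s' : H' \subset K') x,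
    cj eH (res s x) = res s' (cj eK x);
  cj_tr : forall g (H K H' K' : {group gT}) (eH : H' = gconj g H)
      (eK : K' = gconj g K) (s : H \subset K) (s' : H' \subset K') x,
    cj eK (tr s x) = tr s' (cj eH x);
  double_coset : forall (H K L : {group gT}) (sH : H \subset L)
      (sK : K \subset L) (X : {set gT}) x,
    is_transversal X (dcosets K H L) L ->
    res sK (tr sH x) =
      \sum_(g in X) tr (subsetIl K (gconj g H))
                       (cj (gconj_cap g H K) (res (subsetIl H (gconj g^-1 K)) x))
}.

Arguments cj {gT} M g {H K} e : rename.
Arguments res {gT} M {H K} s : rename.
Arguments tr {gT} M {H K} s : rename.

Lemma cj_bij (gT : finGroupType) (M : mackey gT) (g : gT) (H K : {group gT})
  (e : K = gconj g H) : bijective (cj M g e).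
Proof.
have e' : H = gconj g^-1 K.
  by apply: val_inj; rewrite e /= invgK -conjsgM mulVg conjsg1.
have e1 (L : {group gT}) x : x = 1%g -> L = gconj x L.
  by move=> ->; apply: val_inj; rewrite /= invg1 conjsg1.
exists (cj M g^-1 e') => x.
  by rewrite (cj_comp e e' (e1 _ _ (mulVg g))) cj_id // mulVg.
by rewrite (cj_comp e' e (e1 _ _ (mulgV g))) cj_id // mulgV.
Qed.

Definition mackey_hom (gT : finGroupType) (P Q : mackey gT)
    (phi : forall H, {additive P H -> Q H}) : Prop :=
  [/\ forall g (H K : {group gT}) (e : K = gconj g H) x,
        phi K (cj P g e x) = cj Q g e (phi H x),
      forall (H K : {group gT}) (s : H \subset K) x,
        phi H (res P s x) = res Q s (phi K x) &
      forall (H K : {group gT}) (s : H \subset K) x,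
        phi K (tr P s x) = tr Q s (phi H x)].

Section Box.
Variables (gT : finGroupType) (N : nat) (M : 'I_N -> mackey gT).
Implicit Types (H K L : {group gT}).

Definition tens H : zmodType := tensor (fun i => M i H).

(* [dfwith x a] is the family x with its i-th entry replaced by a : M i _. *)
Definition dress_pairing (P : mackey gT)
    (f : forall H, {additive tens H -> P H}) : Prop :=
  [/\ forall H K (s : H \subset K) (x : forall i, M i K),
        f H (pure (fun i => res (M i) s (x i))) = res P s (f K (pure x)),
      forall g H K (e : K = gconj g H) (x : forall i, M i H),
        f K (pure (fun i => cj (M i) g e (x i))) = cj P g e (f H (pure x)) &
      forall H K (s : H \subset K) i (x : forall j, M j K) (y : M i H),
        tr P s (f H (pure (dfwith (fun j => res (M j) s (x j)) y))) =
        f K (pure (dfwith x (tr (M i) s y)))].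

(* f is the universal Dress pairing: phi |-> phi \o f is a bijection, natural
   in P, from morphisms B -> P to Dress pairings to P, and it sends id to f. *)
Definition is_box_product (B : mackey gT)
    (f : forall H, {additive tens H -> B H}) : Prop :=
  dress_pairing f /\
  forall (P : mackey gT) (p : forall H, {additive tens H -> P H}),
    dress_pairing p ->
    exists phi : forall H, {additive B H -> P H},
      [/\ mackey_hom phi, forall H t, phi H (f H t) = p H t &
          forall psi : forall H, {additive B H -> P H},
            mackey_hom psi -> (forall H t, psi H (f H t) = p H t) ->
            forall H x, psi H x = phi H x].

Definition subgrp L : finType := {H : {group gT} | H \subset L}.

Definition box_sum L : zmodType := dsum (fun H : subgrp L => tens (val H)).

Definition inS H L (s : H \subset L) (t : tens H) : box_sum L :=
  dsum_in (A := fun H : subgrp L => tens (val H))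
          (i := exist (fun H => H \subset L) H s) t.

(* The subgroup generated by these differences is F. *)
Inductive box_rel L : box_sum L -> Prop :=
| Frobenius H K (sHK : H \subset K) (sH : H \subset L) (sK : K \subset L) i
    (x : forall j, M j K) (y : M i H) :
    box_rel (inS sK (pure (dfwith x (tr (M i) sHK y)))
             - inS sH (pure (dfwith (fun j => res (M j) sHK (x j)) y)))
| Weyl l H K (e : K = gconj l H) (sH : H \subset L) (sK : K \subset L)
    (x : forall i, M i H) : l \in L ->
    box_rel (inS sH (pure x) - inS sK (pure (fun i => cj (M i) l e (x i)))).

Definition box_value L : zmodType := genquot (@box_rel L).

Definition box_class H L (s : H \subset L) (t : tens H) : box_value L :=
  gencl (@box_rel L) (inS s t).
End Box.

(* Main.v *)
From HB Require Import structures.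
Require Import Defs.
From mathcomp Require Import all_boot all_order all_algebra all_fingroup.
From mathcomp Require Import ring_quotient generic_quotient finmap monalg boolp.
Set Implicit Arguments.
Unset Strict Implicit.
Unset Printing Implicit Defensive.
Import GRing.Theory.
Local Open Scope ring_scope.

(** Rather than start from an abstract box product and compute its values, the
proof makes the groups [box_value M L] themselves into a Mackey functor
[box_mackey M], with conjugation, transfer and restriction given by the
formulas of the statement, and checks that the maps into the summands S_L^L
form a universal Dress pairing.  A universal Dress pairing is unique up to a unique
isomorphism, so any other box product B receives a bijective morphism from
[box_mackey M], and this morphism carries the four formulas over to B.

Universality is the easy half.  By the formula for transfers, the class of a
simple tensor of S_H^L is Tr_H^L (f_H (x_1, ..., x_N)), so a morphism compatible
with a Dress pairing p must send this class to
Tr_H^L (p_H (x_1, ..., x_N)).  The axioms of a Dress pairing say that this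
assignment respects the Frobenius and Weyl relations ([dress_lift]), and
compatibility with restriction is the double coset formula of the target.

The substance lies in the restriction maps.  Each summand of their formula
is a class [res_term L x g] that depends on g only through its double coset LgH
([res_term_invariant]; this uses the Weyl relations), so the sum may be computed
from any family of double coset representatives ([sum_reps]).  Every
property of restriction then becomes a statement on representatives:
- compatibility with Weyl relations and with conjugation: representatives are
  moved by translation ([dcoset_reps_mulr]) or conjugation
  ([dcoset_reps_conj]);
- compatibility with the Frobenius relation at H <= K, functoriality, and the
  double coset formula: all three rest on [dcoset_reps_tower], according to
  which representatives of K\L/J, for J <= H <= L, are the products gh of a
  representative g of K\L/H and a representative h of
  (H :&: g^-1 K g)\H/J.  In the Frobenius case the inner sum is produced by
  the double coset formula of the i-th functor M_i.

All composites of conjugations and restrictions are put in a normal form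
[cjres], indexed by one group element and one inclusion; equalities of
such composites reduce to equalities of group elements up to stabilisers. *)

(** * Universal properties of quotients, direct sums and tensor products *)

Definition additive_of (U V : zmodType) (f : U -> V) (hf : zmod_morphism f) :
    {additive U -> V} :=
  HB.pack f (GRing.isZmodMorphism.Build U V f hf).

Section GeneratedQuotient.
Variables (V : zmodType) (R : V -> Prop).

Lemma gencl_surj (q : genquot R) : exists v, q = gencl R v.
Proof. by exists (repr q); rewrite [RHS]reprK. Qed.

Lemma gencl_rel u v : R (u - v) -> gencl R u = gencl R v.
Proof.
move=> Ruv; apply/eqP; rewrite -[_ == _]Quotient.idealrBE.
by apply/asboolP; apply: gen_mem.
Qed.

(** The additive map is h composed with the choice of a representative. *)
Lemma genquot_lift (W : zmodType) (h : {additive V -> W}) :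
    (forall r, R r -> h r = 0) ->
  {phi : {additive genquot R -> W} | forall v, phi (gencl R v) = h v}.
Proof.
move=> hR.
have h_repr v : h (repr (gencl R v)) = h v.
  apply/eqP; rewrite -subr_eq0 -raddfB; apply/eqP.
  have: repr (gencl R v) - v \in gensub R.
    by rewrite Quotient.idealrBE reprK.
  move/asboolP; elim=> [r /hR // | | u w _ hu _ hw]; first exact: raddf0.
  by rewrite raddfB hu hw subrr.
have add_h : zmod_morphism (h \o repr : genquot R -> W).
  move=> p q; have [[u ->] [v ->]] := (gencl_surj p, gencl_surj q).
  by rewrite -raddfB /= !h_repr raddfB.
by exists (additive_of add_h) => v /=; rewrite h_repr.
Qed.
End GeneratedQuotient.

Section DirectSumTheory.
Variables (I : finType) (A : I -> zmodType).

Lemma dsum_inE i (a : A i) j : dsum_in a j = dfwith (fun k => 0 : A k) a j.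
Proof. by rewrite ffunE. Qed.

Lemma dsum_sumE (J : finType) (F : J -> dsum A) i :
  (\sum_j F j) i = \sum_j F j i.
Proof.
have ev : zmod_morphism (fun u : dsum A => u i) by move=> u v; rewrite !ffunE.
exact: (raddf_sum (additive_of ev)).
Qed.

Lemma dsum_decomp (u : dsum A) : u = \sum_i dsum_in (u i).
Proof.
apply/ffunP=> i; rewrite dsum_sumE (bigD1 i) //= big1 ?addr0.
  by rewrite dsum_inE dfwith_in.
by move=> j ji; rewrite dsum_inE dfwith_out.
Qed.

Lemma dsum_lift (W : zmodType) (h : forall i, {additive A i -> W}) :
  {phi : {additive dsum A -> W} | forall i a, phi (dsum_in a) = h i a}.
Proof.
have add_h : zmod_morphism (fun u : dsum A => \sum_i h i (u i)).
  move=> u v; rewrite -sumrB; apply: eq_bigr => i _.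
  by rewrite !ffunE raddfB.
exists (additive_of add_h) => i a /=.
rewrite (bigD1 i) //= dsum_inE dfwith_in big1 ?addr0 // => j ji.
by rewrite dsum_inE dfwith_out 1?eq_sym // raddf0.
Qed.
End DirectSumTheory.

Section FreeAbelian.
Variable K : choiceType.

Lemma malg_ext (W : zmodType) (f g : {additive {malg K} -> W}) :
  (forall k, f << k >> = g << k >>) -> f =1 g.
Proof.
have mkZ (c : int) (k : K) : << c *g k >> = << k >> *~ c.
  by rewrite -(raddfMz (@mkmalgU K int k)) -mulrzr mul1r intz.
move=> fg m; rewrite (monalgE m) !raddf_sum; apply: eq_bigr => k _.
by rewrite mkZ !raddfMz fg.
Qed.

(** [{malg K}] has integer coefficients: it is the free abelian group on K, and a
map on K extends by linearity. *)
Lemma malg_lift (W : zmodType) (g : K -> W) :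
  {phi : {additive {malg K} -> W} | forall k, phi << k >> = g k}.
Proof.
pose h (m : {malg K}) := \sum_(k <- msupp m) g k *~ m@_k.
have hE (m : {malg K}) (d : {fset K}) : (msupp m `<=` d)%fset ->
    h m = \sum_(k <- d) g k *~ m@_k.
  (* Coefficients vanish off the support, so any larger finite set computes h. *)
  move=> /fsubsetP sd; rewrite /h.
  rewrite [RHS](bigID (fun k => k \in msupp m)) /= [X in _ + X]big1 ?addr0.
    rewrite -[RHS]big_filter; apply: perm_big; apply: uniq_perm.
    - exact: fset_uniq.
    - exact/filter_uniq/fset_uniq.
    by move=> k; rewrite mem_filter; case: (boolP (k \in _)) => // /sd ->.
  by move=> k /mcoeff_outdom->; rewrite mulr0z.
have add_h : zmod_morphism h.
  move=> m n; pose d := (msupp m `|` msupp n)%fset.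
  rewrite !(hE _ d) ?fsubsetUl ?fsubsetUr ?msuppB_le // -sumrB.
  by apply: eq_bigr => k _; rewrite mcoeffB mulrzBr.
exists (additive_of add_h) => k /=.
by rewrite (hE _ [fset k]%fset) ?msuppU_le // big_seq_fset1 mcoeffUU.
Qed.
End FreeAbelian.

Section TensorTheory.
Variables (I : finType) (A : I -> zmodType).
Implicit Types (x : forall i, A i).

Lemma dfwith_map (B : I -> Type) (F : forall i, A i -> B i) x i (a : A i) :
  (fun j => F j (dfwith x a j)) = dfwith (fun j => F j (x j)) (F i a).
Proof.
apply: functional_extensionality_dep => j.
by case: (eqVneq i j) => [<-|ij]; rewrite ?dfwith_in ?dfwith_out.
Qed.

Definition multilinear (W : zmodType) (g : (forall i, A i) -> W) :=
  forall x i (a b : A i),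
    g (dfwith x (a + b)) = g (dfwith x a) + g (dfwith x b).

Lemma pure_multilinear : multilinear (@pure I A).
Proof.
move=> x i a b; apply/eqP; rewrite -subr_eq0 opprD addrA; apply/eqP.
rewrite /pure -!raddfB -(raddf0 (gencl (@multilinear_rel I A))).
by apply: gencl_rel; rewrite subr0; constructor.
Qed.

Lemma tensor_ext (W : zmodType) (f g : {additive tensor A -> W}) :
  (forall x, f (pure x) = g (pure x)) -> f =1 g.
Proof.
move=> fg t; have [m ->] := gencl_surj t.
pose simple_class := gencl (@multilinear_rel I A).
apply: (malg_ext (f := f \o simple_class) (g := g \o simple_class)) => k /=.
have <- : fam (fun i => k i) = k by apply/ffunP=> i; rewrite ffunE.
exact: fg.
Qed.

Lemma tensor_lift (W : zmodType) (g : (forall i, A i) -> W) :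
    multilinear g ->
  {phi : {additive tensor A -> W} | forall x, phi (pure x) = g x}.
Proof.
move=> mg.
have [h hE] := malg_lift (fun k : {dffun forall i, A i} => g (fun i => k i)).
have hfam x : h << fam x >> = g x.
  by rewrite hE; congr g; apply: functional_extensionality_dep => i; rewrite ffunE.
have [|phi phiE] := genquot_lift (R := @multilinear_rel I A) (h := h).
  by move=> _ [x i a b]; rewrite !raddfB /= !hfam mg addrAC addrK subrr.
by exists phi => x; rewrite phiE hfam.
Qed.

Lemma multilinear_sum (W : zmodType) (g : (forall i, A i) -> W)
    (J : Type) (r : seq J) (P : pred J) x i (F : J -> A i) :
  multilinear g ->
  g (dfwith x (\sum_(j <- r | P j) F j)) =
    \sum_(j <- r | P j) g (dfwith x (F j)).
Proof.
move=> mg.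
have gB : zmod_morphism (fun a : A i => g (dfwith x a)).
  by move=> a b; apply/eqP; rewrite eq_sym subr_eq -mg subrK.
exact: (raddf_sum (additive_of gB)).
Qed.
End TensorTheory.

(** * Conjugate subgroups *)

Section Conjugation.
Variable gT : finGroupType.
Implicit Types (g h x : gT) (H K L : {group gT}).

Lemma mem_gconj g H x : (x \in gconj g H) = (x ^ g \in H)%g.
Proof. by rewrite /= mem_conjgV. Qed.

Lemma gconjM g h H : gconj (g * h)%g H = gconj g (gconj h H).
Proof. by apply/val_inj; rewrite /= invMg conjsgM. Qed.

Lemma gconj_id h H : h \in H -> gconj h H = H.
Proof. by move=> hH; apply/val_inj; rewrite /= conjGid ?groupV. Qed.

Lemma gconj1 H : gconj 1 H = H.
Proof. exact: gconj_id. Qed.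

Lemma gconjS g H K : H \subset K -> gconj g H \subset gconj g K.
Proof. by rewrite /= conjSg. Qed.

Lemma gconjI g H K : gconj g (H :&: K)%G = (gconj g H :&: gconj g K)%G.
Proof. by apply/val_inj; rewrite /= conjIg. Qed.
End Conjugation.

(** * Representatives of double cosets *)

Section DoubleCosets.
Variable gT : finGroupType.
Implicit Types (g h k x y : gT) (H J K L : {group gT}).
Local Open Scope group_scope.

Lemma dcosetP K H g y :
  reflect (exists k h, [/\ k \in K, h \in H & y = k * g * h])
          (y \in K :* g * H).
Proof.
apply: (iffP mulsgP) => [[_ h /rcosetP[k kK ->] hH ->]|[k [h [kK hH ->]]]].
  by exists k, h.
by exists (k * g) h => //; apply/rcosetP; exists k.
Qed.

Lemma mem_dcoset_repr K H g : g \in K :* g * H.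
Proof. by apply/dcosetP; exists 1, 1; rewrite !group1 mul1g mulg1. Qed.

Lemma dcoset_eq K H g y : y \in K :* g * H -> K :* y * H = K :* g * H.
Proof.
case/dcosetP=> k [h [kK hH ->]].
by rewrite !rcosetM (rcoset_id kK) -(mulgA (K :* g)) (lcoset_id hH).
Qed.

(** Families indexed by any finite type are allowed, not only subsets of L: the
representatives built from others below are indexed by pairs. *)
Definition dcoset_reps (I : finType) (P : pred I) (r : I -> gT) K H L :=
  [/\ forall i, P i -> r i \in L,
      forall x, x \in L -> exists2 i, P i & x \in K :* r i * H
    & forall i j, P i -> P j -> r j \in K :* r i * H -> i = j].

Definition dcoset_invariant (T : Type) (F : gT -> T) K H :=
  forall k h g, k \in K -> h \in H -> F (k * g * h) = F g.

Lemma dcoset_reps_transversal K H L (X : {set gT}) :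
  is_transversal X (dcosets K H L) L -> dcoset_reps [in X] id K H L.
Proof.
move=> trX; have /and3P[/and3P[/eqP cov tiP _] XL _] := trX.
have dcP x : x \in L -> K :* x * H \in dcosets K H L.
  by move=> xL; apply/imsetP; exists x.
have pbE x : x \in L -> pblock (dcosets K H L) x = K :* x * H.
  by move=> xL; apply: def_pblock (dcP _ xL) (mem_dcoset_repr _ _ _).
split=> [x|x xL|x y xX yX]; first exact: (subsetP XL).
  have := repr_mem_transversal trX 1 (dcP x xL).
  set y := transversal_repr _ _ _ => yX; exists y => //.
  have /dcoset_eq -> := repr_mem_pblock trX 1 (dcP x xL).
  exact: mem_dcoset_repr.
move=> /dcoset_eq yx; apply: (pblock_inj trX) => //.
by rewrite !pbE ?(subsetP XL).
Qed.

Lemma dcosets_partition K H L :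
  K \subset L -> H \subset L -> partition (dcosets K H L) L.
Proof.
move=> sK sH; have sub g : g \in L -> K :* g * H \subset L.
  by move=> gL; rewrite !mul_subG ?sub1set.
apply/and3P; split.
- rewrite eqEsubset; apply/andP; split.
    by apply/bigcupsP=> _ /imsetP[g gL ->]; apply: sub.
  apply/subsetP=> g gL; apply/bigcupP; exists (K :* g * H).
    by apply/imsetP; exists g.
  exact: mem_dcoset_repr.
- apply/trivIsetP=> _ _ /imsetP[g _ ->] /imsetP[h _ ->].
  apply: contraR => /pred0Pn[x /andP[/= xg xh]].
  by rewrite -(dcoset_eq xg) -(dcoset_eq xh).
apply/imsetP=> -[g _ /setP/(_ g)].
by rewrite mem_dcoset_repr inE.
Qed.

Lemma transversal_dcosets K H L : K \subset L -> H \subset L ->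
  is_transversal (transversal (dcosets K H L) L) (dcosets K H L) L.
Proof. by move=> sK sH; apply/transversalP/dcosets_partition. Qed.

(** Both sums are compared with the sum, over the set of double cosets D, of the
value of F at the canonical element of D. *)
Lemma sum_reps (V : zmodType) (F : gT -> V) K H L
    (I J : finType) (P : pred I) (Q : pred J) r s :
    dcoset_invariant F K H -> dcoset_reps P r K H L -> dcoset_reps Q s K H L ->
  (\sum_(i | P i) F (r i) = \sum_(j | Q j) F (s j))%R.
Proof.
move=> Finv.
suff E (I' : finType) (P' : pred I') r' : dcoset_reps P' r' K H L ->
    (\sum_(i | P' i) F (r' i) = \sum_(D in dcosets K H L) F (fingroup.repr D))%R.
  by move=> /E-> /E->.
case=> r'L r'ex r'inj.
have -> : dcosets K H L = [set K :* r' i * H | i in P'].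
  apply/setP=> D; apply/imsetP/imsetP=> -[x Px ->].
    by have [i Pi /dcoset_eq->] := r'ex x Px; exists i.
  by exists (r' x) => //; apply: r'L.
rewrite big_imset /=.
  apply: eq_bigr => i _.
  have /dcosetP[k [h [kK hH ->]]] := mem_repr _ (mem_dcoset_repr K H (r' i)).
  by rewrite Finv.
move=> i j Pi Pj eqD; apply: r'inj => //.
by rewrite eqD mem_dcoset_repr.
Qed.

(** KgH is the union over h of the sets KghJ, and KghJ = Kgh'J exactly when h and
h' lie in the same double coset of H modulo (g^-1 K g :&: H, J).  This is
the set-theoretic content of the transitivity of iterated restrictions and
transfers. *)
Lemma dcoset_reps_tower K H J L (I I' : finType) (P : pred I) (Q : I -> pred I')
    (r : I -> gT) (s : I -> I' -> gT) :
    H \subset L -> J \subset H -> dcoset_reps P r K H L ->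
    (forall i, P i -> dcoset_reps (Q i) (s i) (H :&: gconj (r i)^-1 K)%G J H) ->
  dcoset_reps (fun p : I * I' => P p.1 && Q p.1 p.2)
              (fun p => r p.1 * s p.1 p.2) K J L.
Proof.
move=> sHL sJH [rL rex rinj] sreps; split=> [[i j] /andP[/= Pi Qij]|x xL|].
- by have [sH _ _] := sreps i Pi; rewrite groupM ?rL // (subsetP sHL) ?sH.
- have [i Pi /dcosetP[k [h [kK hH ->]]]] := rex x xL.
  have [_ sex _] := sreps i Pi.
  have [j Qij /dcosetP[a [b [/setIP[_]]]]] := sex h hH.
  rewrite mem_gconj => aK bJ ->; exists (i, j); first exact/andP.
  apply/dcosetP; exists (k * a ^ (r i)^-1), b.
  by rewrite groupM //; split=> //; rewrite conjgE invgK !mulgA mulgKV.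
move=> [i j] [i' j'] /andP[/= Pi Qij] /andP[/= Pi' Qij'].
case/dcosetP=> k [a [kK aJ /= E]]; have aH := subsetP sJH a aJ.
have [sH _ sinj] := sreps i Pi; have [sH' _ _] := sreps i' Pi'.
(* Both points lie in the same K r H double coset, as the s-parts and a are in H. *)
have eqi : i = i'.
  apply: rinj => //; apply/dcosetP; exists k, (s i j * a * (s i' j')^-1).
  rewrite !groupM ?groupV ?sH ?sH' //; split=> //.
  by apply: (mulIg (s i' j')); rewrite [LHS]E !mulgA mulgKV.
move: Qij' E sH'; rewrite -{i' Pi'}eqi => Qij' E sH'.
congr (_, _); apply: sinj => //; apply/dcosetP; exists (k ^ r i), a; split=> //.
  rewrite inE mem_gconj conjgK kK andbT.
  have -> : k ^ r i = s i j' * a^-1 * (s i j)^-1.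
    by rewrite conjgE -[s i j'](mulKg (r i)) E !mulgA !mulgK.
  by rewrite !groupM ?groupV ?sH ?sH'.
by rewrite -[LHS](mulKg (r i)) E conjgE !mulgA.
Qed.

(** Inversion exchanges the two sides of a tower: it turns [dcoset_reps_tower]
into its mirror image, in which it is the left subgroup that shrinks. *)
Lemma dcoset_reps_inv K H L (I : finType) (P : pred I) r :
  dcoset_reps P r K H L -> dcoset_reps P (fun i => (r i)^-1) H K L.
Proof.
have dcV k g h : (k * g * h)^-1 = h^-1 * g^-1 * k^-1 by rewrite !invMg mulgA.
have memV (A B : {group gT}) x y : (x^-1 \in B :* y^-1 * A) = (x \in A :* y * B).
  apply/dcosetP/dcosetP=> -[k [h [kK hH E]]]; exists h^-1, k^-1.
    by rewrite !groupV -[y in RHS]invgK -dcV -E invgK.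
  by rewrite !groupV E dcV.
case=> rL rex rinj; split=> [i Pi|x xL|i j Pi Pj]; first by rewrite groupV rL.
  have [|i Pi xi] := rex x^-1; first by rewrite groupV.
  by exists i => //; rewrite -(invgK x) memV.
by rewrite memV; apply: rinj.
Qed.

Lemma dcoset_reps_conj g K H L (I : finType) (P : pred I) r :
  dcoset_reps P r K H L ->
  dcoset_reps P (fun i => r i ^ g^-1) (gconj g K) (gconj g H) (gconj g L).
Proof.
have memJ x y : (x \in gconj g K :* y ^ g^-1 * gconj g H) = (x ^ g \in K :* y * H).
  by rewrite -[RHS](memJ_conjg _ g^-1) !conjsMg conjg_set1 conjgK.
case=> rL rex rinj; split=> [i Pi|x|i j Pi Pj].
- by rewrite mem_gconj conjgKV rL.
- by rewrite mem_gconj => /rex[i Pi]; rewrite -memJ; exists i.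
by rewrite memJ conjgKV; apply: rinj.
Qed.

Lemma dcoset_reps_mulr l K H L (I : finType) (P : pred I) r :
  l \in L -> dcoset_reps P r K H L ->
  dcoset_reps P (fun i => r i * l^-1) K (gconj l H) L.
Proof.
have memM x y : (x \in K :* (y * l^-1) * gconj l H) = (x * l \in K :* y * H).
  by rewrite /= conjsgE invgK !mulgA -rcosetM mulgKV mem_rcoset invgK.
move=> lL [rL rex rinj]; split=> [i Pi|x xL|i j Pi Pj].
- by rewrite groupM ?groupV ?rL.
- by have [|i Pi] := rex (x * l); [rewrite groupM | rewrite -memM; exists i].
by rewrite memM mulgKV; apply: rinj.
Qed.

Lemma dcoset_reps1 K L : dcoset_reps [pred g : gT | g == 1] id K L L.
Proof.
split=> [_ /eqP->|x xL|i j /eqP-> /eqP->] //.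
by exists 1 => //=; apply/dcosetP; exists 1, x; rewrite group1 !mul1g.
Qed.
End DoubleCosets.

(** * Conjugation followed by restriction *)

Section OrbitMaps.
Variables (gT : finGroupType) (M : mackey gT).
Implicit Types (g h : gT) (H J K L : {group gT}).

(** The map induced by the map of orbits G/J -> G/H that sends J to gH.  It depends
on g only modulo right multiplication by H ([cjres_mulr]), and these maps are
closed under composition ([cjres_comp]), so every composite of conjugations and
restrictions has this form. *)
Definition cjres g H J (s : J \subset gconj g H) : {additive M H -> M J} :=
  res M s \o cj M g (erefl (gconj g H)).

Lemma res_cj g H J K (e : K = gconj g H) (s : J \subset K)
    (s' : J \subset gconj g H) x : res M s (cj M g e x) = cjres s' x.
Proof. by subst K; rewrite /cjres /= (eq_irrelevance s s'). Qed.

Lemma cj_cjres g H J (e : J = gconj g H) (s : J \subset gconj g H) x :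
  cj M g e x = cjres s x.
Proof. by rewrite -(res_cj e (subxx J)) res_id. Qed.

Lemma cjres_id h H (s : H \subset gconj h H) x : h \in H -> cjres s x = x.
Proof. by move=> hH; rewrite -(cj_cjres (esym (gconj_id hH))) cj_id. Qed.

Lemma res_cjres H J (s : J \subset H) (s' : J \subset gconj 1 H) x :
  res M s x = cjres s' x.
Proof. by rewrite -(res_cj (esym (gconj1 H)) s) cj_id. Qed.

Lemma cjres_comp g g' H J K (s : K \subset gconj g H) (s' : J \subset gconj g' K)
    (s'' : J \subset gconj (g' * g) H) x : cjres s' (cjres s x) = cjres s'' x.
Proof.
rewrite /cjres /= (cj_res erefl erefl s (gconjS g' s)).
rewrite (cj_comp erefl erefl (esym (gconjM g' g H))).
rewrite (res_comp _ _ (subset_trans s' (gconjS g' s))).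
exact: res_cj.
Qed.

Lemma cjres_eq g g' H J (s : J \subset gconj g H) (s' : J \subset gconj g' H) x :
  g = g' -> cjres s x = cjres s' x.
Proof. by move=> eg; subst g'; rewrite (eq_irrelevance s s'). Qed.

Lemma cjres_mulr g h H J (s : J \subset gconj g H)
    (s' : J \subset gconj (g * h) H) x : h \in H -> cjres s x = cjres s' x.
Proof.
move=> hH; have t : H \subset gconj h H by rewrite gconj_id.
by rewrite -(cjres_comp t s) cjres_id.
Qed.

Lemma cj_res_cjres g H J K (e : K = gconj g J) (s : J \subset H)
    (s' : K \subset gconj g H) x : cj M g e (res M s x) = cjres s' x.
Proof.
have t : J \subset gconj 1 H by rewrite gconj1.
have t' : K \subset gconj g J by rewrite e.
have t'' : K \subset gconj (g * 1) H by rewrite mulg1.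
rewrite (res_cjres _ t) (cj_cjres _ t') (cjres_comp _ _ t'').
exact/cjres_eq/mulg1.
Qed.

Lemma res_of_cjres g H J K (s : J \subset gconj g H) (t : K \subset J)
    (s' : K \subset gconj g H) x : res M t (cjres s x) = cjres s' x.
Proof. exact: res_comp. Qed.

(** The double coset formula after transport by g.  The representatives k run over
K rather than its conjugate, so that they can be multiplied with g as in
[dcoset_reps_tower]. *)
Lemma double_coset_cjres g H K L (sH : H \subset K) (X : {set gT})
    (s : L :&: gconj g K \subset gconj g K)
    (s' : forall k,
       (L :&: gconj g K) :&: gconj (g * k) H \subset gconj (g * k) H) y :
    is_transversal X (dcosets (K :&: gconj g^-1 L)%G H K) K ->
  cjres s (tr M sH y) =
  \sum_(k in X) tr M (subsetIl (L :&: gconj g K)%G (gconj (g * k) H))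
                   (cjres (s' k) y).
Proof.
move=> trX.
rewrite -(cj_res_cjres (gconj_cap g K L) (subsetIl _ _)).
rewrite (double_coset _ _ _ trX) raddf_sum; apply: eq_bigr => k _ /=.
have e : (L :&: gconj g K :&: gconj (g * k) H)%G =
         gconj g ((K :&: gconj g^-1 L) :&: gconj k H)%G.
  by rewrite gconjI -gconj_cap gconjM.
rewrite (cj_tr e _ _ (subsetIl _ _)); congr (tr M _ _).
rewrite (cj_res_cjres _ _ (subsetIr _ _)).
have t : (L :&: gconj g K :&: gconj (g * k) H)%G \subset
         gconj g ((K :&: gconj g^-1 L) :&: gconj k H)%G by rewrite -e.
by rewrite (cj_cjres _ t) (cjres_comp _ _ (s' k)).
Qed.
End OrbitMaps.

(** * Classes of simple tensors *)

Section BoxValues.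
Variables (gT : finGroupType) (N : nat) (M : 'I_N -> mackey gT).
Implicit Types (g h k : gT) (H J K L : {group gT}).
Local Notation vals H := (forall i, M i H).

Definition simple_class H L (s : H \subset L) (x : vals H) : box_value M L :=
  box_class s (pure x).

Lemma box_class_additive H L (s : H \subset L) :
  zmod_morphism (@box_class gT N M H L s).
Proof. by move=> t u; rewrite /box_class /inS !raddfB. Qed.

Lemma simple_class_multilinear H L (s : H \subset L) : multilinear (simple_class s).
Proof.
move=> x i a b; rewrite /simple_class pure_multilinear.
exact: (raddfD (additive_of (box_class_additive s))).
Qed.

(** The classes of simple tensors generate [box_value M L]. *)
Lemma box_ext L (W : zmodType) (f g : {additive box_value M L -> W}) :
    (forall H (s : H \subset L) x, f (simple_class s x) = g (simple_class s x)) ->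
  f =1 g.
Proof.
move=> fg q; have [u ->] := gencl_surj q; rewrite (dsum_decomp u) !raddf_sum.
apply: eq_bigr => -[H s] _.
pose F (phi : {additive box_value M L -> W}) :=
  phi \o additive_of (@box_class_additive H L s).
by apply: (tensor_ext (f := F f) (g := F g)) => x; apply: fg.
Qed.

Lemma box_lift L (W : zmodType) (h : forall H, H \subset L -> vals H -> W) :
    (forall H (s : H \subset L), multilinear (h H s)) ->
    (forall H K (sHK : H \subset K) (sH : H \subset L) (sK : K \subset L) i
        (x : vals K) (y : M i H),
      h K sK (dfwith x (tr (M i) sHK y)) =
      h H sH (dfwith (fun j => res (M j) sHK (x j)) y)) ->
    (forall l H K (e : K = gconj l H) (sH : H \subset L) (sK : K \subset L) x,
      l \in L -> h H sH x = h K sK (fun i => cj (M i) l e (x i))) ->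
  {phi : {additive box_value M L -> W} |
    forall H (s : H \subset L) x, phi (simple_class s x) = h H s x}.
Proof.
move=> hmul hfrob hweyl.
pose F (U : subgrp L) := tensor_lift (hmul (val U) (valP U)).
have [f fE] := dsum_lift (fun U : subgrp L => sval (F U)).
have fS H (s : H \subset L) x : f (inS s (pure x)) = h H s x.
  rewrite /inS fE (svalP (F (exist (fun H => H \subset L) H s))) /=.
  have irr (s1 s2 : H \subset L) : h H s1 x = h H s2 x.
    by rewrite (eq_irrelevance s1 s2).
  exact: irr.
have [|phi phiE] := genquot_lift (R := @box_rel gT N M L) (h := f).
  move=> _ [H K sHK sH sK i x y|l H K e sH sK x lL]; rewrite raddfB /= !fS.
    by rewrite (hfrob _ _ sHK sH) subrr.
  by rewrite (hweyl _ _ _ e _ sK) // subrr.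
by exists phi => H s x; rewrite /simple_class /box_class phiE fS.
Qed.

Lemma simple_class_frobenius H K L (sHK : H \subset K) (sH : H \subset L)
    (sK : K \subset L) i (x : vals K) (y : M i H) :
  simple_class sK (dfwith x (tr (M i) sHK y)) =
  simple_class sH (dfwith (fun j => res (M j) sHK (x j)) y).
Proof. by apply: gencl_rel; apply: Frobenius. Qed.

Definition cjres_fam g H J (s : J \subset gconj g H) (x : vals H) : vals J :=
  fun i => cjres (M i) s (x i).

Lemma cjres_fam_comp g g' H J K (s : K \subset gconj g H)
    (s' : J \subset gconj g' K)
    (s'' : J \subset gconj (g' * g) H) x :
  cjres_fam s' (cjres_fam s x) = cjres_fam s'' x.
Proof. by apply: functional_extensionality_dep => i; apply: cjres_comp. Qed.

Lemma cjres_fam_dfwith g H J (s : J \subset gconj g H) x i (y : M i H) :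
  cjres_fam s (dfwith x y) = dfwith (cjres_fam s x) (cjres (M i) s y).
Proof. exact: (dfwith_map (fun j => cjres (M j) s)). Qed.

Lemma simple_class_cj l H K L (sH : H \subset L) (sK : K \subset L)
    (s : K \subset gconj l H) x :
  l \in L -> K = gconj l H -> simple_class sH x = simple_class sK (cjres_fam s x).
Proof.
move=> lL e; have -> : cjres_fam s x = fun i => cj (M i) l e (x i).
  by apply: functional_extensionality_dep => i; rewrite (cj_cjres _ s).
by apply: gencl_rel; apply: Weyl.
Qed.

(** The Weyl relation on elements in normal form: multiplying g on the left by an
element of L moves the subgroup J within L, and on the right by an element of H
changes nothing. *)
Lemma simple_class_weyl l h g g' H J K L (s : J \subset gconj g H)
    (s' : K \subset gconj g' H) (sJ : J \subset L) (sK : K \subset L) x :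
    l \in L -> h \in H -> g' = (l * g * h)%g -> K = gconj l J ->
  simple_class sJ (cjres_fam s x) = simple_class sK (cjres_fam s' x).
Proof.
move=> lL hH eg eK; have t : K \subset gconj l J by rewrite eK.
have t' : K \subset gconj (l * g) H by rewrite eK gconjM gconjS.
have t'' : K \subset gconj (l * g * h) H by rewrite -eg.
rewrite (simple_class_cj sJ sK t) // (cjres_fam_comp _ _ t').
congr (simple_class sK _); apply: functional_extensionality_dep => i.
by rewrite /cjres_fam (cjres_mulr _ t'') //; apply/cjres_eq.
Qed.

(** The summand indexed by g in the restriction to L of the class of x. *)
Definition res_term L H x g : box_value M L :=
  simple_class (subsetIl L (gconj g H)) (cjres_fam (subsetIr L (gconj g H)) x).

Lemma simple_class_term g H J L (s : J \subset gconj g H) (sJ : J \subset L) x :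
  J = (L :&: gconj g H)%G -> simple_class sJ (cjres_fam s x) = res_term L x g.
Proof.
move=> eJ; apply: (@simple_class_weyl 1%g 1%g); rewrite ?group1 ?mul1g ?mulg1 //.
by rewrite gconj1.
Qed.

Lemma res_term_invariant L H x : dcoset_invariant (@res_term L H x) L H.
Proof.
move=> l h g lL hH; apply/esym; apply: (simple_class_weyl _ _ _ _ _ lL hH erefl).
by rewrite gconjI (gconj_id lL) !gconjM (gconj_id hH).
Qed.

(** This is how two successive operations merge into one: c_k c_g = c_kg, and the
hypothesis puts both terms in the same summand of the direct sum. *)
Lemma res_term_cjres g k H J L (s : J \subset gconj g H) x :
    (L :&: gconj k J)%G = (L :&: gconj (k * g) H)%G ->
  res_term L (cjres_fam s x) k = res_term L x (k * g)%g.
Proof.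
move=> e; have t : (L :&: gconj k J)%G \subset gconj (k * g) H.
  by rewrite e subsetIr.
by rewrite /res_term (cjres_fam_comp _ _ t); apply: simple_class_term.
Qed.

Lemma res_term_multilinear L H g : multilinear (fun x => @res_term L H x g).
Proof.
move=> x i a b.
by rewrite /res_term !cjres_fam_dfwith raddfD simple_class_multilinear.
Qed.
End BoxValues.

(** * Conjugation, transfer and restriction on the quotients *)

Section BoxMackey.
Variables (gT : finGroupType) (N : nat) (M : 'I_N -> mackey gT).
Implicit Types (g h k : gT) (H J K L : {group gT}).
Local Notation vals H := (forall i, M i H).

Lemma gconj_sub g H K L : K = gconj g L -> H \subset L -> gconj g H \subset K.
Proof. by move=> ->; apply: gconjS. Qed.

Lemma box_cj_lift g L L' (e : L' = gconj g L) :
  {phi : {additive box_value M L -> box_value M L'} |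
    forall H (s : H \subset L) (x : vals H),
      phi (simple_class s x) =
      simple_class (gconj_sub e s) (cjres_fam (subxx (gconj g H)) x)}.
Proof.
apply: (box_lift (h := fun H s x =>
  simple_class (gconj_sub e s) (cjres_fam (subxx (gconj g H)) x))).
- by move=> H s x i a b; rewrite !cjres_fam_dfwith raddfD simple_class_multilinear.
- move=> H K sHK sH sK i x y; have t := gconjS g sHK.
  have trE : cjres (M i) (subxx _) (tr (M i) sHK y) =
             tr (M i) t (cjres (M i) (subxx _) y).
    by rewrite -!(cj_cjres erefl) (cj_tr erefl erefl sHK t).
  have resE : (fun j => res (M j) t (cjres_fam (subxx _) x j)) =
              cjres_fam (subxx _) (fun j => res (M j) sHK (x j)).
    apply: functional_extensionality_dep => j.
    rewrite /cjres_fam (res_of_cjres _ _ t).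
    by rewrite -(cj_cjres erefl) (cj_res_cjres _ _ t).
  by rewrite !cjres_fam_dfwith trE (simple_class_frobenius _ (gconj_sub e sH)) resE.
- move=> l H K eK sH sK x lL; subst K.
  have t : gconj g (gconj l H) \subset gconj (g * l) H by rewrite gconjM.
  have -> : cjres_fam (subxx (gconj g (gconj l H)))
                      (fun i => cj (M i) l erefl (x i)) =
            cjres_fam t x.
    apply: functional_extensionality_dep => i.
    rewrite /cjres_fam (cj_cjres _ (subxx _)).
    exact: cjres_comp.
  apply: (simple_class_weyl (l := (l ^ g^-1)%g) (h := 1%g)) => //.
  + by rewrite e mem_gconj conjgKV.
  + by rewrite mulg1 -conjgCV.
  by rewrite -!gconjM -conjgCV.
Qed.

Definition box_cj g L L' (e : L' = gconj g L) := sval (box_cj_lift e).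

(** J is any subgroup equal to the conjugate of H, which avoids transports later. *)
Lemma box_cjE g H J L L' (e : L' = gconj g L) (s : H \subset L) (s' : J \subset L')
    (t : J \subset gconj g H) (x : vals H) :
  J = gconj g H -> box_cj e (simple_class s x) = simple_class s' (cjres_fam t x).
Proof.
move=> eJ; rewrite /box_cj (svalP (box_cj_lift e)).
by apply: (@simple_class_weyl _ _ _ 1%g 1%g); rewrite ?group1 ?mul1g ?mulg1 ?gconj1.
Qed.

Lemma box_tr_lift L L' (sL : L \subset L') :
  {phi : {additive box_value M L -> box_value M L'} |
    forall H (s : H \subset L) (x : vals H),
      phi (simple_class s x) = simple_class (subset_trans s sL) x}.
Proof.
apply: (box_lift (h := fun H s x => simple_class (subset_trans s sL) x)).
- by move=> H s; apply: simple_class_multilinear.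
- by move=> H K sHK sH sK i x y; apply: simple_class_frobenius.
move=> l H K e sH sK x lL; have t : K \subset gconj l H by rewrite e.
rewrite (simple_class_cj _ (subset_trans sK sL) t) ?(subsetP sL) //.
have -> // : cjres_fam t x = fun i => cj (M i) l e (x i).
by apply: functional_extensionality_dep => i; rewrite (cj_cjres _ t).
Qed.

Definition box_tr L L' (sL : L \subset L') := sval (box_tr_lift sL).

Lemma box_trE H L L' (sL : L \subset L') (s : H \subset L) (s' : H \subset L')
    (x : vals H) : box_tr sL (simple_class s x) = simple_class s' x.
Proof.
by rewrite /box_tr (svalP (box_tr_lift sL)) (eq_irrelevance (subset_trans _ _) s').
Qed.

(** Restriction respects the Frobenius relation.  For fixed g in X the i-th entry of
the term is c_g Res Tr_H^K y, which the double coset formula of M_i splits into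
transfers indexed by representatives k in K.  The Frobenius relation inside L
removes each of these transfers and leaves the term of index gk on the
right-hand side. *)
Lemma sum_res_term_frobenius H K L L' (sHK : H \subset K) (X Y : {set gT}) i
    (x : vals K) (y : M i H) : H \subset L' -> K \subset L' -> L \subset L' ->
    is_transversal X (dcosets L K L') L' ->
    is_transversal Y (dcosets L H L') L' ->
  \sum_(g in X) res_term L (dfwith x (tr (M i) sHK y)) g =
  \sum_(g in Y) res_term L (dfwith (fun j => res (M j) sHK (x j)) y) g.
Proof.
move=> sH sK sL trX trY.
pose Z g := transversal (dcosets (K :&: gconj g^-1 L)%G H K) K.
have trZ g : is_transversal (Z g) (dcosets (K :&: gconj g^-1 L)%G H K) K.
  by apply: transversal_dcosets; rewrite ?subsetIl.
have repsZ g (_ : g \in X) := dcoset_reps_transversal (trZ g).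
have rT := dcoset_reps_tower sK sHK (dcoset_reps_transversal trX) repsZ.
rewrite -(sum_reps (@res_term_invariant _ _ M L H _) rT
                   (dcoset_reps_transversal trY)).
rewrite -(pair_big_dep [in X] (fun g => [in Z g])
  (fun g k => res_term L (dfwith (fun j => res (M j) sHK (x j)) y) (g * k)%g)) /=.
apply: eq_bigr => g gX.
rewrite [in LHS]/res_term cjres_fam_dfwith.
rewrite (double_coset_cjres _ _ (fun k => subsetIr _ _) _ (trZ g)).
rewrite (multilinear_sum _ _ _ _ (simple_class_multilinear _)).
apply: eq_bigr => k /[dup] kZ /(subsetP (transversal_sub (trZ g))) kK.
have sHk : gconj (g * k) H \subset gconj g K.
  by rewrite gconjM gconjS // -(gconj_id kK) gconjS.
have e : (L :&: gconj g K :&: gconj (g * k) H)%G = (L :&: gconj (g * k) H)%G.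
  by apply/val_inj; rewrite /= -setIA (setIidPr sHk).
have sL' : (L :&: gconj g K :&: gconj (g * k) H)%G \subset L.
  by rewrite e subsetIl.
have resE : (fun j => res (M j) (subsetIl (L :&: gconj g K)%G (gconj (g * k) H))
                         (cjres_fam (subsetIr L (gconj g K)) x j)) =
            cjres_fam (subsetIr (L :&: gconj g K)%G (gconj (g * k) H))
                (fun j => res (M j) sHK (x j)).
  apply: functional_extensionality_dep => j; rewrite /cjres_fam.
  have t : H \subset gconj 1 K by rewrite gconj1.
  have t' : (L :&: gconj g K :&: gconj (g * k) H)%G \subset gconj g K.
    by rewrite (subset_trans (subsetIl _ _)) ?subsetIr.
  have t'' : (L :&: gconj g K :&: gconj (g * k) H)%G \subset gconj (g * k * 1) K.
    by rewrite mulg1 (gconjM g k K) (gconj_id kK).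
  rewrite (res_of_cjres _ _ t') (res_cjres _ t) (cjres_comp _ _ t'').
  (* The entries j <> i come from K, where c_k acts trivially. *)
  by move: t''; rewrite -mulgA mulg1 => t''; apply: cjres_mulr.
rewrite (simple_class_frobenius _ sL') resE -cjres_fam_dfwith.
exact: simple_class_term.
Qed.

Lemma box_res_lift L L' (sL : L \subset L') :
  {phi : {additive box_value M L' -> box_value M L} |
    forall H (s : H \subset L') (x : vals H),
      phi (simple_class s x) =
      \sum_(g in transversal (dcosets L H L') L') res_term L x g}.
Proof.
apply: (box_lift
  (h := fun H _ x => \sum_(g in transversal (dcosets L H L') L') res_term L x g)).
- move=> H s x i a b; rewrite -big_split /=; apply: eq_bigr => g _.
  exact: res_term_multilinear.
- move=> H K sHK sH sK i x y.
  by apply: (sum_res_term_frobenius (L' := L')) => //; apply: transversal_dcosets.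
move=> l H K e sH sK x lL; subst K.
have rX := dcoset_reps_mulr lL
  (dcoset_reps_transversal (transversal_dcosets sL sH)).
have rY := dcoset_reps_transversal (transversal_dcosets sL sK).
rewrite -(sum_reps (@res_term_invariant _ _ M L _ _) rX rY); apply: eq_bigr => g _.
have -> : (fun i => cj (M i) l erefl (x i)) = cjres_fam (subxx (gconj l H)) x.
  by apply: functional_extensionality_dep => i; rewrite (cj_cjres _ (subxx _)).
by rewrite res_term_cjres ?mulgKV // -gconjM mulgKV.
Qed.

Definition box_res L L' (sL : L \subset L') := sval (box_res_lift sL).

Lemma box_resE H L L' (sL : L \subset L') (s : H \subset L') (x : vals H)
    (I : finType) (P : pred I) r :
    dcoset_reps P r L H L' ->
  box_res sL (simple_class s x) = \sum_(i | P i) res_term L x (r i).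
Proof.
move=> rP; rewrite /box_res (svalP (box_res_lift sL)).
exact: (sum_reps (@res_term_invariant _ _ M L _ _)
                 (dcoset_reps_transversal (transversal_dcosets sL s)) rP).
Qed.
End BoxMackey.
Arguments box_cj {gT N M g L L'} e.
Arguments box_tr {gT N M L L'} sL.
Arguments box_res {gT N M L L'} sL.

(** * The Mackey functor axioms *)

Section BoxProduct.
Variables (gT : finGroupType) (N : nat) (M : 'I_N -> mackey gT).
Implicit Types (g h k : gT) (H J K L : {group gT}).
Local Notation vals H := (forall i, M i H).

Lemma box_cj_id H h (e : H = gconj h H) (q : box_value M H) :
  h \in H -> box_cj e q = q.
Proof.
move=> hH; apply: (box_ext (f := box_cj e) (g := idfun)) => J s x.
rewrite (box_cjE e s (gconj_sub e s) (subxx _)) //.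
by rewrite -(simple_class_cj s).
Qed.

Lemma box_cj_comp g g' H K L (e : K = gconj g H) (e' : L = gconj g' K)
    (e'' : L = gconj (g' * g) H) (q : box_value M H) :
  box_cj e' (box_cj e q) = box_cj e'' q.
Proof.
apply: (box_ext (f := box_cj e' \o box_cj e) (g := box_cj e'')) => J s x /=.
have t : gconj g' (gconj g J) \subset gconj (g' * g) J by rewrite gconjM.
rewrite (box_cjE e s (gconj_sub e s) (subxx _)) //.
rewrite (box_cjE e' _ (gconj_sub e' (gconj_sub e s)) (subxx _)) //.
rewrite (cjres_fam_comp _ _ t); apply/esym/box_cjE.
by rewrite gconjM.
Qed.

Lemma box_res_id H (s : H \subset H) (q : box_value M H) : box_res s q = q.
Proof.
apply: (box_ext (f := box_res s) (g := idfun)) => J sJ x /=.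
rewrite (box_resE s sJ x (dcoset_reps_inv (dcoset_reps1 J H))) big_pred1_eq invg1.
have t : J \subset gconj 1 J by rewrite gconj1.
rewrite -(simple_class_term t sJ); last first.
  by apply/val_inj; rewrite gconj1 /= (setIidPr sJ).
by rewrite -(simple_class_cj sJ sJ t) ?gconj1.
Qed.

Lemma box_res_comp H K L (s : H \subset K) (s' : K \subset L) (s'' : H \subset L)
    (q : box_value M L) : box_res s (box_res s' q) = box_res s'' q.
Proof.
apply: (box_ext (f := box_res s \o box_res s') (g := box_res s'')) => J sJ x /=.
pose X := transversal (dcosets K J L) L.
have trX : is_transversal X (dcosets K J L) L by apply: transversal_dcosets.
pose Y g := transversal (dcosets H (K :&: gconj g J)%G K) K.
have trY g : is_transversal (Y g) (dcosets H (K :&: gconj g J)%G K) K.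
  by apply: transversal_dcosets; rewrite ?subsetIl.
(* The subgroup that shrinks, from K to H, is on the left: the tower lemma is
   applied to the inverses. *)
have rY g (_ : g \in X) : dcoset_reps [in Y g] invg (K :&: gconj g^-1^-1 J)%G H K.
  by rewrite invgK; apply: dcoset_reps_inv (dcoset_reps_transversal (trY g)).
have rT := dcoset_reps_inv
  (dcoset_reps_tower s' s (dcoset_reps_inv (dcoset_reps_transversal trX)) rY).
rewrite (box_resE s' sJ x (dcoset_reps_transversal trX)) raddf_sum.
rewrite (box_resE s'' sJ x rT).
rewrite -(pair_big_dep [in X] (fun g => [in Y g])
  (fun g k => res_term H x (g^-1 * k^-1)^-1%g)) /=.
apply: eq_bigr => g gX.
rewrite /res_term (box_resE s _ _ (dcoset_reps_transversal (trY g))).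
apply: eq_bigr => k /(subsetP (transversal_sub (trY g))) kK.
rewrite invMg !invgK; apply: res_term_cjres.
rewrite gconjI (gconj_id kK) -gconjM; apply/val_inj.
by rewrite /= setIA (setIidPl s).
Qed.

Lemma box_tr_id H (s : H \subset H) (q : box_value M H) : box_tr s q = q.
Proof.
apply: (box_ext (f := box_tr s) (g := idfun)) => J sJ x /=.
exact: box_trE.
Qed.

Lemma box_tr_comp H K L (s : H \subset K) (s' : K \subset L) (s'' : H \subset L)
    (q : box_value M H) : box_tr s' (box_tr s q) = box_tr s'' q.
Proof.
apply: (box_ext (f := box_tr s' \o box_tr s) (g := box_tr s'')) => J sJ x /=.
by rewrite (box_trE s sJ (subset_trans sJ s)) !(box_trE _ _ (subset_trans sJ s'')).
Qed.

Lemma box_cj_res g H K H' K' (eH : H' = gconj g H) (eK : K' = gconj g K)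
    (s : H \subset K) (s' : H' \subset K') (q : box_value M K) :
  box_cj eH (box_res s q) = box_res s' (box_cj eK q).
Proof.
apply: (box_ext (f := box_cj eH \o box_res s) (g := box_res s' \o box_cj eK)).
move=> J sJ x /=.
have rX := dcoset_reps_transversal (transversal_dcosets s sJ).
rewrite (box_resE s sJ x rX) raddf_sum.
rewrite (box_cjE eK sJ (gconj_sub eK sJ) (subxx _)) //.
have rX' := dcoset_reps_conj g rX; rewrite -eH -eK in rX'.
rewrite (box_resE s' _ _ rX'); apply: eq_bigr => k _.
pose T := gconj g (H :&: gconj k J)%G.
have sT : T \subset H' by rewrite eH gconjS ?subsetIl.
have tT : T \subset gconj (g * k) J by rewrite gconjM gconjS ?subsetIr.
have eT : T = (H' :&: gconj (g * k) J)%G by rewrite /T gconjI -eH gconjM.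
rewrite /res_term (box_cjE eH _ sT (subxx _)) // (cjres_fam_comp _ _ tT).
rewrite (simple_class_term _ _ _ eT).
by rewrite -/(res_term _ _ _) res_term_cjres -conjgCV // -gconjM -conjgCV.
Qed.

Lemma box_cj_tr g H K H' K' (eH : H' = gconj g H) (eK : K' = gconj g K)
    (s : H \subset K) (s' : H' \subset K') (q : box_value M H) :
  box_cj eK (box_tr s q) = box_tr s' (box_cj eH q).
Proof.
apply: (box_ext (f := box_cj eK \o box_tr s) (g := box_tr s' \o box_cj eH)).
move=> J sJ x /=; rewrite (box_trE s sJ (subset_trans sJ s)).
rewrite (box_cjE eH sJ (gconj_sub eH sJ) (subxx _)) //.
rewrite (box_trE _ _ (gconj_sub eK (subset_trans sJ s))).
exact: box_cjE.
Qed.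

Lemma box_double_coset H K L (sH : H \subset L) (sK : K \subset L)
    (X : {set gT}) (q : box_value M H) :
    is_transversal X (dcosets K H L) L ->
  box_res sK (box_tr sH q) =
  \sum_(g in X) box_tr (subsetIl K (gconj g H))
    (box_cj (gconj_cap g H K) (box_res (subsetIl H (gconj g^-1 K)) q)).
Proof.
move=> trX.
(* The right-hand side as one additive map, so that simple classes suffice. *)
pose S (q : box_value M H) := \sum_(g in X) box_tr (subsetIl K (gconj g H))
    (box_cj (gconj_cap g H K) (box_res (subsetIl H (gconj g^-1 K)) q)).
have addS : zmod_morphism S.
  by move=> u v; rewrite -sumrB; apply: eq_bigr => g _; rewrite !raddfB.
apply: (box_ext (f := box_res sK \o box_tr sH) (g := additive_of addS)).
move=> J sJ x; rewrite /= /S (box_trE sH sJ (subset_trans sJ sH)).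
pose Y g := transversal (dcosets (H :&: gconj g^-1 K)%G J H) H.
have trY g : is_transversal (Y g) (dcosets (H :&: gconj g^-1 K)%G J H) H.
  by apply: transversal_dcosets; rewrite ?subsetIl.
have rY g (_ : g \in X) := dcoset_reps_transversal (trY g).
have rT := dcoset_reps_tower sH sJ (dcoset_reps_transversal trX) rY.
rewrite (box_resE _ _ _ rT).
rewrite -(pair_big_dep [in X] (fun g => [in Y g])
  (fun g k => res_term K x (g * k)%g)) /=.
apply: eq_bigr => g gX; rewrite (box_resE _ _ _ (rY g gX)) !raddf_sum.
apply: eq_bigr => k /(subsetP (transversal_sub (trY g))) kH.
pose T := gconj g ((H :&: gconj g^-1 K) :&: gconj k J)%G.
have sT : T \subset (K :&: gconj g H)%G.
  by rewrite gconj_cap gconjS ?subsetIl.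
have tT : T \subset gconj (g * k) J by rewrite gconjM gconjS ?subsetIr.
have sJk : gconj k J \subset H by rewrite -(gconj_id kH) gconjS.
have eT : T = (K :&: gconj (g * k) J)%G.
  rewrite /T gconjI -gconj_cap gconjM; apply/val_inj.
  by rewrite /= -setIA (setIidPr (gconjS g sJk)).
rewrite /res_term (box_cjE _ _ sT (subxx _)) // (cjres_fam_comp _ _ tT).
rewrite (box_trE _ _ (subset_trans sT (subsetIl _ _))).
by rewrite (simple_class_term _ _ _ eT).
Qed.

(** * The universal Dress pairing *)

Definition box_mackey : mackey gT :=
  Mackey box_cj_id box_cj_comp box_res_id box_res_comp box_tr_id box_tr_comp
         box_cj_res box_cj_tr box_double_coset.

Definition box_dress H : {additive tens M H -> box_mackey H} :=
  additive_of (@box_class_additive gT N M H H (subxx H)).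

(** Compatibility with restriction: H\K/K is a single double coset, so the
restriction of a class coming from S_K^K has one term.  Compatibility with
transfer is a Frobenius relation. *)
Lemma box_dress_pairing : dress_pairing box_dress.
Proof.
split=> [H K s x|g H K e x|H K s i x y].
- rewrite /= -/(simple_class _ _) -/(simple_class _ _).
  rewrite (box_resE s _ _ (dcoset_reps1 H K)) big_pred1_eq.
  have t : H \subset gconj 1 K by rewrite gconj1.
  rewrite -(simple_class_term t (subxx H)); last first.
    by rewrite gconj1; apply/val_inj; rewrite /= (setIidPl s).
  have -> // : cjres_fam t x = fun i => res (M i) s (x i).
  by apply: functional_extensionality_dep => i; rewrite (res_cjres _ t).
- have t : K \subset gconj g H by rewrite e.
  rewrite /= -/(simple_class _ _) -/(simple_class _ _) (box_cjE e _ (subxx K) t) //.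
  have -> // : cjres_fam t x = fun i => cj (M i) g e (x i).
  by apply: functional_extensionality_dep => i; rewrite (cj_cjres _ t).
rewrite /= -/(simple_class _ _) -/(simple_class _ _).
by rewrite (box_trE s _ s) (simple_class_frobenius _ s).
Qed.

Lemma cjres_fam_cap g H K (x : vals H) :
  cjres_fam (subsetIr K (gconj g H)) x =
  (fun i => cj (M i) g (gconj_cap g H K)
              (res (M i) (subsetIl H (gconj g^-1 K)) (x i))).
Proof.
apply: functional_extensionality_dep => i.
by rewrite (cj_res_cjres _ _ (subsetIr _ _)).
Qed.

Section Universal.
Variables (P : mackey gT) (p : forall H, {additive tens M H -> P H}).
Variable p_dress : dress_pairing p.

(** The Frobenius relations become equalities by the compatibility of p with
transfers, and the Weyl relations by its compatibility with conjugation, because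
an element of L acts trivially on P(G/L). *)
Lemma dress_lift L :
  {phi : {additive box_mackey L -> P L} |
    forall H (s : H \subset L) (x : vals H),
      phi (simple_class s x) = tr P s (p H (pure x))}.
Proof.
have [_ p_cj p_tr] := p_dress.
apply: (box_lift (h := fun H s x => tr P s (p H (pure x)))).
- by move=> H s x i a b; rewrite pure_multilinear !raddfD.
- move=> H K sHK sH sK i x y.
  by rewrite -p_tr (tr_comp _ _ sH).
move=> l H K e sH sK x lL; rewrite (p_cj l H K e x).
by rewrite -(cj_tr e (esym (gconj_id lL)) sH) cj_id.
Qed.

Definition dress_map L := sval (dress_lift L).

Lemma dress_mapE H L (s : H \subset L) (x : vals H) :
  dress_map L (simple_class s x) = tr P s (p H (pure x)).
Proof. exact: (svalP (dress_lift L)). Qed.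

Lemma dress_map_hom : mackey_hom dress_map.
Proof.
have [p_res p_cj _] := p_dress.
split=> [g H K e q|H K s q|H K s q].
- apply: (box_ext (f := dress_map K \o box_cj e) (g := cj P g e \o dress_map H)).
  move=> J sJ x /=; rewrite (box_cjE e sJ (gconj_sub e sJ) (subxx _)) //.
  rewrite !dress_mapE (cj_tr erefl e sJ (gconj_sub e sJ)) -p_cj.
  have -> // : cjres_fam (subxx (gconj g J)) x = fun i => cj (M i) g erefl (x i).
  by apply: functional_extensionality_dep => i; rewrite (cj_cjres _ (subxx _)).
- apply: (box_ext (f := dress_map H \o box_res s) (g := res P s \o dress_map K)).
  move=> J sJ x /=; have trX := transversal_dcosets s sJ.
  rewrite (box_resE s sJ x (dcoset_reps_transversal trX)) raddf_sum dress_mapE.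
  rewrite (double_coset sJ s _ trX); apply: eq_bigr => g _.
  by rewrite /res_term dress_mapE cjres_fam_cap p_cj p_res.
apply: (box_ext (f := dress_map K \o box_tr s) (g := tr P s \o dress_map H)).
move=> J sJ x /=; rewrite (box_trE s sJ (subset_trans sJ s)) !dress_mapE.
by rewrite (tr_comp _ _ (subset_trans sJ s)).
Qed.

Lemma dress_map_box_dress H t : dress_map H (box_dress H t) = p H t.
Proof.
apply: (tensor_ext (f := dress_map H \o box_dress H) (g := p H)) => x /=.
by rewrite -/(simple_class _ _) dress_mapE tr_id.
Qed.

(** A class in S_H^L is the transfer from H to L of a value of the pairing. *)
Lemma dress_map_unique (psi : forall H, {additive box_mackey H -> P H}) :
    mackey_hom psi -> (forall H t, psi H (box_dress H t) = p H t) ->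
  forall H q, psi H q = dress_map H q.
Proof.
move=> [_ _ psi_tr] psi_f H; apply: box_ext => J s x.
have -> : simple_class s x = tr box_mackey s (box_dress J (pure x)).
  exact/esym/box_trE.
by rewrite psi_tr psi_f -dress_mapE; congr (dress_map H _); apply/esym/box_trE.
Qed.
End Universal.

Lemma box_mackey_box_product : is_box_product box_dress.
Proof.
split=> [|P p pP]; first exact: box_dress_pairing.
exists (dress_map pP); split.
- exact: dress_map_hom.
- exact: dress_map_box_dress.
exact: dress_map_unique.
Qed.

(** The usual rigidity of universal objects, which makes comparison morphisms
between two box products mutually inverse. *)
Lemma box_product_endo (B : mackey gT) (f : forall H, {additive tens M H -> B H})
    (psi : forall H, {additive B H -> B H}) :
    is_box_product f -> mackey_hom psi -> (forall H t, psi H (f H t) = f H t) ->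
  forall H, psi H =1 id.
Proof.
move=> [fD univ] psiM psif H q; have [phi [_ _ uniq]] := univ B f fD.
rewrite (uniq psi) // -(uniq (fun H => idfun : {additive B H -> B H})) //.
Qed.
End BoxProduct.

Lemma mackey_hom_comp (gT : finGroupType) (P Q R : mackey gT)
    (psi : forall H, {additive Q H -> R H})
    (phi : forall H, {additive P H -> Q H}) :
  mackey_hom psi -> mackey_hom phi -> mackey_hom (fun H => psi H \o phi H).
Proof.
move=> [c1 r1 t1] [c2 r2 t2].
by split=> [g H K e x|H K s x|H K s x] /=; rewrite ?c2 ?c1 ?r2 ?r1 ?t2 ?t1.
Qed.

Theorem theoremD (gT : finGroupType) (N : nat) (M : 'I_N -> mackey gT) :
  (exists (B : mackey gT) (f : forall H, {additive tens M H -> B H}),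
     is_box_product f) /\
  forall (B : mackey gT) (f : forall H, {additive tens M H -> B H}),
    is_box_product f ->
    exists Phi : forall L : {group gT}, {additive box_value M L -> B L},
      (forall L, bijective (Phi L)) /\
      [/\ forall g (L L' H H' : {group gT}) (eL : L' = gconj g L)
            (eH : H' = gconj g H) (s : H \subset L) (s' : H' \subset L')
            (x : forall i, M i H),
            cj B g eL (Phi L (box_class s (pure x))) =
            Phi L' (box_class s' (pure (fun i => cj (M i) g eH (x i)))),
          forall (H L L' : {group gT}) (s : H \subset L) (s' : H \subset L')
            (sL : L \subset L') (t : tens M H),
            tr B sL (Phi L (box_class s t)) = Phi L' (box_class s' t),
          forall (H L L' : {group gT}) (sH : H \subset L') (sL : L \subset L')
            (X : {set gT}) (x : forall i, M i H),
            is_transversal X (dcosets L H L') L' ->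
            res B sL (Phi L' (box_class sH (pure x))) =
            \sum_(g in X) Phi L (box_class (subsetIl L (gconj g H))
              (pure (fun i => cj (M i) g (gconj_cap g H L)
                                (res (M i) (subsetIl H (gconj g^-1 L)) (x i)))))
        & forall (L : {group gT}) (t : tens M L),
            f L t = Phi L (box_class (subxx L) t)].
Proof.
split.
  by exists (box_mackey M), (@box_dress gT N M); apply: box_mackey_box_product.
move=> B f fB; have f0B := box_mackey_box_product M.
have [fD f_univ] := fB; have [f0D f0_univ] := f0B.
have [phi [phiM phif _]] := f0_univ B f fD.
have [psi [psiM psif _]] := f_univ _ _ f0D.
exists phi; split=> [L|].
  exists (psi L).
    apply: (box_product_endo f0B (mackey_hom_comp psiM phiM)) => H t /=.
    by rewrite phif psif.
  apply: (box_product_endo fB (mackey_hom_comp phiM psiM)) => H t /=.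
  by rewrite psif phif.
have [phi_cj phi_res phi_tr] := phiM.
split=> [g L L' H H' eL eH s s' x|H L L' s s' sL t|H L L' sH sL X x trX|L t].
- have u : H' \subset gconj g H by rewrite eH.
  rewrite -phi_cj; congr (phi L' _).
  rewrite [LHS](box_cjE eL s s' u) //.
  have -> // : cjres_fam u x = fun i => cj (M i) g eH (x i).
  by apply: functional_extensionality_dep => i; rewrite (cj_cjres _ u).
- rewrite -phi_tr; congr (phi L' _).
  apply: (tensor_ext
    (f := box_tr sL \o additive_of (@box_class_additive gT N M _ _ s))
    (g := additive_of (@box_class_additive gT N M _ _ s'))) => x.
  exact: box_trE.
- rewrite -phi_res -raddf_sum; congr (phi L _).
  rewrite [LHS](box_resE sL sH x (dcoset_reps_transversal trX)).
  by apply: eq_bigr => g _; rewrite /res_term cjres_fam_cap.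
by rewrite -phif.
Qed.
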